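(* For $n\ge 1$ and $k\ge 0$, let $\mathcal{D}_{n,k}(021)$ denote the set of 021-avoiding descent sequences of length $n$ with exactly $k$ descents. Then $$|\mathcal{D}_{n,k}(021)|=\binom{n+k}{3k+1}\,C_k,$$ where $C_k$ is the $k$-th Catalan number.
   Context: A descent sequence of length $n$ is a sequence $a_1a_2\dots a_n$ of nonnegative integers with $a_1=0$ and, for each $i\ge 2$, $a_i\le 1+\#\{j\in[1,i-2]: a_j>a_{j+1}\}$. The number of descents of $a_1\dots a_n$ is $\#\{j\in[1,n-1]: a_j>a_{j+1}\}$. A sequence avoids 021 if there are no indices $i<j<k$ with $a_i<a_k<a_j$. $C_k=\frac{1}{k+1}\binom{2k}{k}$, and $\binom{m}{r}=0$ for integers $r>m\ge 0$. *)

(* Defs.v *)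
(* MathComp, with mathcomp-classical for sets and cardinalities. *)
From HB Require Import structures.
From mathcomp Require Export all_boot.
From mathcomp Require Export boolp classical_sets functions cardinality.

Set Implicit Arguments.
Unset Strict Implicit.
Unset Printing Implicit Defensive.

(* A sequence a_1 ... a_n is a list s : seq nat of size n, with a_i being
   nth 0 s i.-1: all positions below are 0-based. *)

Definition des (s : seq nat) : nat :=
  #|[set j : 'I_(size s).-1 | nth 0 s j > nth 0 s j.+1]|.

(* The entry at 0-based position i is a_(i+1), whose bound counts the descents
   j in [1, i-1] of the whole sequence; these are the descents of the prefix
   a_1 ... a_i = take i s. *)
Definition descent_sequence (s : seq nat) : Prop :=
  nth 0 s 0 = 0 /\
  forall i, 0 < i < size s -> nth 0 s i <= 1 + des (take i s).

Definition avoids021 (s : seq nat) : Prop :=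
  ~ exists i j k, [/\ i < j, j < k, k < size s &
                      nth 0 s i < nth 0 s k < nth 0 s j].

Definition D021 (n k : nat) : set (seq nat) :=
  [set s : seq nat | [/\ size s = n, descent_sequence s, avoids021 s &
                         des s = k]]%classic.

Definition catalan (k : nat) : nat := 'C(2 * k, k) %/ k.+1.

(* The division in catalan is exact. *)
Lemma catalan_exact (k : nat) : catalan k * k.+1 = 'C(2 * k, k).
Proof.
have E := mul_bin_left (2 * k) k.
rewrite mul2n -addnn addnK in E.
apply: divnK; rewrite mul2n -addnn.
have <- : k.+1 * ('C(k + k, k) - 'C(k + k, k.+1)) = 'C(k + k, k).
  by rewrite mulnBr E -mulnBl subSnn mul1n.
exact: dvdn_mulr.
Qed.

(* Main.v *)
Require Import Defs.
From mathcomp Require Import zify.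

(* As a_1 = 0, avoiding 021 means that the nonzero entries increase weakly, and
   descents occur exactly from a nonzero entry to 0. The completions of a prefix
   with d descents and last nonzero entry v then depend only on the slack
   s = d + 1 - v and on whether the last entry is 0. If r entries and q descents
   remain, there are 'C(r + q + s + 1, 3q + s + 1) B(q, s) completions after a 0,
   where B is the ballot triangle B(q, s) = B(q, s - 1) + B(q - 1, s + 1) with
   B(q, 0) = C_q; the numbers of completions after a nonzero entry, summed over
   the slacks at most s, give 'C(r + q + s + 1, 3q + s) B(q, s), and both formulas
   follow together by Pascal's rule. The theorem is the case s = 0, r = n - 1. *)

Lemma des_cons (x y : nat) (t : seq nat) :
  des (x :: y :: t) = (y < x) + des (y :: t).
Proof.
rewrite /des -!sum1dep_card big_mkcond /= big_ord_recl /=.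
by rewrite [in RHS]big_mkcond; congr (_ + _).
Qed.

Fixpoint desc (p : nat) (t : seq nat) : nat :=
  if t is x :: t' then (x < p) + desc x t' else 0.

Lemma des_desc (p : nat) (t : seq nat) : des (p :: t) = desc p t.
Proof.
elim: t p => [|x t IH] p; last by rewrite des_cons IH.
by rewrite /des -sum1dep_card big_mkcond big_ord0.
Qed.

(* Here [t] follows an entry [p] preceded by [d] descents. *)
Fixpoint bounded (d p : nat) (t : seq nat) : bool :=
  if t is x :: t' then (x <= d.+1) && bounded (d + (x < p)) x t' else true.

Lemma boundedP (d p : nat) (t : seq nat) :
  reflect (forall i, i < size t -> nth 0 t i <= d.+1 + desc p (take i t))
          (bounded d p t).
Proof.
apply: (iffP idP).
  elim: t d p => [|x t IH] d p //= /andP[le_x bt] [|i] /=; first by rewrite addn0.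
  by rewrite ltnS => /(IH _ _ bt); rewrite addnA addSn.
elim: t d p => [|x t IH] d p //= h; apply/andP; split.
  by have := h 0 isT; rewrite /= addn0.
by apply: IH => i lti; have := h i.+1 lti; rewrite /= addnA addSn.
Qed.

Lemma descent_sequence_cons (x : nat) (t : seq nat) :
  descent_sequence (x :: t) <-> x = 0 /\ bounded 0 0 t.
Proof.
rewrite /descent_sequence /=; split=> -[-> h]; split=> //.
  by apply/boundedP => i lti; have := h i.+1 lti; rewrite /= des_desc.
by case=> // i /= lti; rewrite des_desc; apply: (boundedP _ _ _ h).
Qed.

(** The leading 0 turns every inversion among the nonzero entries into a 021; conversely, the two
    larger entries of a 021 are nonzero and form such an inversion. *)
Lemma avoids021_cons0 (t : seq nat) :
  avoids021 (0 :: t) <-> sorted leq [seq x <- t | 0 < x].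
Proof.
rewrite (sorted_pairwise leq_trans).
split=> [av | srt [i [j [k [ltij ltjk ltk /andP[ik kj]]]]]].
  have {}av i j : i < j < size t -> 0 < nth 0 t j -> nth 0 t i <= nth 0 t j.
    case/andP=> ltij ltj j0; rewrite leqNgt; apply/negP => ltji; apply: av.
    by exists 0, i.+1, j.+1; rewrite /= j0.
  elim: t av => [|x t IH] av //=.
  have {}IH : pairwise leq [seq y <- t | 0 < y].
    by apply: IH => i j ltij; apply: (av i.+1 j.+1).
  case: ifP => // x0 /=; rewrite IH andbT; apply/allP => y.
  rewrite mem_filter => /andP[y0 /(nthP 0)[j ltj Ej]].
  by have := av 0 j.+1; rewrite /= Ej; apply.
case: j k ltij ltjk ltk ik kj => [|j] [|k] // ltij ltjk ltk ik kj.
move: ltjk ltk kj; rewrite !ltnS /= => ltjk ltk kj.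
have {i ltij ik} k0 : 0 < nth 0 t k by apply: leq_ltn_trans ik.
elim: t j k ltjk ltk kj k0 srt => [|x t IH] [|j] [|k] //= ltjk ltk kj k0.
  rewrite (ltn_trans k0 kj) /= => /andP[/allP /(_ (nth 0 t k))].
  by rewrite mem_filter k0 mem_nth // leqNgt kj => /(_ isT).
by case: (0 < x) => [/= /andP[_]|]; apply: (IH j k).
Qed.

(* The completions by [r] entries and [q] descents of a prefix with [d] descents,
   whose last nonzero entry is [v] (with [v = 1] when there is none) and whose
   last entry is [v] if [b] holds and [0] otherwise. *)
Fixpoint suffixes (r q d v : nat) (b : bool) : seq (seq nat) :=
  if r is r'.+1 then
    [seq 0 :: t | t <- if b then if q is q'.+1 then suffixes r' q' d.+1 v false
                                 else [::]
                       else suffixes r' q d v false]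
      ++ [seq x :: t | x <- iota v (d.+2 - v), t <- suffixes r' q d x true]
  else if q is 0 then [:: [::]] else [::].

(** As [v] is positive, a first entry 0 can come only from the first branch of [suffixes], where it
    uses up a descent exactly when [b] holds; an entry at least [v] makes no descent. *)
Lemma mem_suffixes (r q d v : nat) (b : bool) (t : seq nat) : 0 < v ->
  (t \in suffixes r q d v b) =
  [&& size t == r, bounded d (if b then v else 0) t,
      path leq v [seq x <- t | 0 < x] & desc (if b then v else 0) t == q].
Proof.
elim: r q d v b t => [|r IH] q d v b t v0 /=.
  by case: q t => [|q] [|x t].
rewrite mem_cat; case: t => [|x t] /=.
  by apply/norP; split; [apply/mapP => -[] | apply/allpairsPdep => -[? [? []]]].
set A := (A in map _ A).
have -> : (x :: t \in map (cons 0) A) = (x == 0) && (t \in A).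
  apply/mapP/andP => [[u uA [-> ->]] | [/eqP-> tA]]; last by exists t.
  by rewrite eqxx.
have -> : (x :: t \in [seq y :: u | y <- iota v (d.+2 - v), u <- suffixes r q d y true])
          = (v <= x <= d.+1) && (t \in suffixes r q d x true).
  apply/allpairsPdep/andP => [[y [u [yI uS [-> ->]]]] | [xI tS]].
    by move: yI; rewrite mem_iota uS => /andP[? ?]; split=> //; lia.
  by exists x, t; split=> //; rewrite mem_iota; lia.
rewrite eqSS; case: x => [|x] /=.
  rewrite leqNgt v0 orbF /A; case: b {A} => /=; rewrite ?addn0 ?ltn0 ?v0.
    case: q => [|q]; first by rewrite !andbF.
    by rewrite IH // addn1 eqSS.
  by rewrite IH.
rewrite IH //=; have [vx|xv] := leqP v x.+1 => /=; last by rewrite !andbF.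
have -> : (x.+1 < if b then v else 0) = false by case: b {A}; lia.
by rewrite addn0 add0n -!andbA andbCA.
Qed.

Lemma suffixes_uniq (r q d v : nat) (b : bool) : 0 < v -> uniq (suffixes r q d v b).
Proof.
elim: r q d v b => [|r IH] q d v b v0 /=; first by case: q.
rewrite cat_uniq; apply/and3P; split.
- rewrite map_inj_uniq; last by move=> ? ? [].
  by case: b; [case: q => [|q] |]; rewrite ?IH.
- apply/hasPn => _ /allpairsPdep[x [t [xI _ ->]]].
  by apply/mapP => -[u _ [x0 _]]; move: xI; rewrite mem_iota x0; lia.
- apply: allpairs_uniq_dep; first exact: iota_uniq.
    by move=> x; rewrite mem_iota => xI; apply: IH; lia.
  by move=> [x t] [y u] _ _ /= [-> ->].
Qed.

(* [s] is the slack d + 1 - v, on which alone the size of [suffixes r q d v b]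
   depends. *)
Fixpoint nsuffixes (r q s : nat) (b : bool) : nat :=
  if r is r'.+1 then
    (if b then if q is q'.+1 then nsuffixes r' q' s.+1 false else 0
     else nsuffixes r' q s false) + \sum_(i < s.+1) nsuffixes r' q i true
  else q == 0.

Lemma size_suffixes (r q s v : nat) (b : bool) :
  size (suffixes r q (v + s) v.+1 b) = nsuffixes r q s b.
Proof.
elim: r q s v b => [|r IH] q s v b /=; first by case: q.
rewrite size_cat size_map; congr (_ + _).
  by case: b; [case: q => // q; rewrite -addnS IH | rewrite IH].
rewrite size_allpairs_dep sumnE big_map.
have -> : (v + s).+2 - v.+1 = s.+1 by lia.
(* As the next nonzero entry grows from [v.+1], its slack falls from [s] to 0: the head of the list
   is the last term of the sum. *)
elim: s v => [|s IHs] v.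
  by rewrite /= big_seq1 big_ord_recl big_ord0 IH !addn0.
rewrite big_ord_recr /= big_cons addnC IH; congr (_ + _).
by rewrite -(IHs v.+1) addnS addSn.
Qed.

(** These count the paths with [q + s] up and [q] down steps that never go below 0. Summing out the
    recurrence in [s] leaves a recursion on [q] alone. *)
Fixpoint ballot (q s : nat) : nat :=
  if q is q'.+1 then \sum_(i < s.+1) ballot q' i.+1 else 1.

Lemma ballotS0 (q : nat) : ballot q.+1 0 = ballot q 1.
Proof. by rewrite /= big_ord_recl big_ord0 addn0. Qed.

Lemma ballotSS (q s : nat) : ballot q.+1 s.+1 = ballot q.+1 s + ballot q s.+2.
Proof. by rewrite /= big_ord_recr. Qed.

(** The formula of the reflection principle, obtained here from Pascal's rule. The lower index
    [q + s.+1] mirrors [q - 1] and makes the term vanish at [q = 0]. *)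
Lemma ballot_bin (q s : nat) :
  ballot q s + 'C(2 * q + s, q + s.+1) = 'C(2 * q + s, q).
Proof.
elim: q s => [|q IHq] s; first by rewrite bin_small // bin0.
elim: s => [|s IHs].
  have -> : 2 * q.+1 + 0 = (2 * q + 1).+1 by lia.
  have := IHq 1; rewrite ballotS0 addn2.
  have -> : q.+1 + 1 = q.+2 by lia.
  by rewrite !(binS (2 * q + 1)); lia.
have := IHq s.+2; rewrite ballotSS.
have -> : 2 * q + s.+2 = 2 * q.+1 + s by lia.
have -> : 2 * q.+1 + s.+1 = (2 * q.+1 + s).+1 by lia.
have -> : q.+1 + s.+2 = (q + s.+2).+1 by lia.
move: IHs; have -> : q.+1 + s.+1 = q + s.+2 by lia.
by rewrite !(binS (2 * q.+1 + s)) (addnS q s.+2); lia.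
Qed.

Lemma ballot_catalan (q : nat) : ballot q 0 = catalan q.
Proof.
apply/eqP; rewrite -(eqn_pmul2r (ltn0Sn q)) catalan_exact; apply/eqP.
(* Since [q.+1 * 'C(2 * q, q.+1) = q * 'C(2 * q, q)], the difference of the two binomials times
   [q.+1] is ['C(2 * q, q)]. *)
have := ballot_bin q 0; have := mul_bin_left (2 * q) q.
rewrite addn0 addn1; nia.
Qed.

Lemma nsuffixes_bin (r q s : nat) :
  nsuffixes r q s false = 'C(r + q + s.+1, 3 * q + s.+1) * ballot q s /\
  \sum_(i < s.+1) nsuffixes r q i true = 'C(r + q + s.+1, 3 * q + s) * ballot q s.
Proof.
elim: r q s => [|r IH] q s.
  split; case: q => [|q] /=.
  - by rewrite binn.
  - by rewrite bin_small //; lia.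
  - by rewrite sum_nat_const card_ord !add0n binSn.
  - by rewrite big1 // bin_small //; lia.
split.
  rewrite /= (IH q s).1 (IH q s).2 -mulnDl; congr (_ * _).
  by rewrite !addSn !addnS binS.
elim: s => [|s IHs].
  rewrite big_ord_recl big_ord0 addn0 /= (IH q 0).2.
  case: q => [|q]; first by rewrite !bin0.
  rewrite (IH q 1).1 ballotS0 -mulnDl.
  congr (_ * _).
  have -> : r.+1 + q.+1 + 1 = (r + q + 2).+1 by lia.
  have -> : 3 * q.+1 + 0 = (3 * q + 2).+1 by lia.
  by rewrite binS addnC; congr ('C(_, _) + _); lia.
have -> : \sum_(i < s.+2) nsuffixes r.+1 q i true
          = \sum_(i < s.+1) nsuffixes r.+1 q i true + nsuffixes r.+1 q s.+1 true.
  exact: big_ord_recr.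
rewrite IHs [nsuffixes _ _ _ _]/= (IH q s.+1).2.
(* With no descent left, 0 cannot follow a nonzero entry, so that term is absent. *)
case: q {IHs} => [|q].
  rewrite !muln1 !addn0 muln0 !add0n -addSnnS.
  by rewrite [r.+1 + _]addSn binS addnC -!addSnnS.
(* [ballot q.+1 s] and [ballot q s.+2] carry the same binomial and add up to [ballot q.+1 s.+1],
   which leaves Pascal's rule. *)
rewrite (IH q s.+2).1 ballotSS.
have -> : r.+1 + q.+1 + s.+2 = (r + q + s.+3).+1 by lia.
have -> : 3 * q.+1 + s.+1 = (3 * q + s.+3).+1 by lia.
rewrite binS.
have -> : r.+1 + q.+1 + s.+1 = r + q + s.+3 by lia.
have -> : r + q.+1 + s.+2 = r + q + s.+3 by lia.
have -> : 3 * q.+1 + s = 3 * q + s.+3 by lia.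
nia.
Qed.

Lemma card_eq_seq (T : eqType) (s : seq T) :
  uniq s -> ([set` s] #= `I_(size s))%card.
Proof.
move=> us.
have -> : `I_(size s) = (index^~ s @` [set` s])%classic.
  apply/seteqP; split=> [i /= lti | _ [x /= xs <-]]; last by rewrite index_mem.
  (* The head of the list serves as default value for [nth]. *)
  case: s us lti => // x s us lti.
  by exists (nth x (x :: s) i); [exact: mem_nth | exact: index_uniq].
apply/card_esym/inj_card_eq => x y; rewrite !inE => xs ys.
exact: index_inj.
Qed.

Theorem theorem10 (n k : nat) (hn : 1 <= n) :
  (D021 n k #= `I_('C(n + k, 3 * k + 1) * catalan k))%card.
Proof.
case: n hn => // n _.
have -> : D021 n.+1 k = [set` map (cons 0) (suffixes n k 0 1 false)]%classic.
  apply/seteqP; split=> [[|x t] [] //= [st] /descent_sequence_cons[-> bt] av dt|].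
    apply: map_f; rewrite mem_suffixes // st eqxx bt; move: dt av.
    rewrite des_desc => -> /avoids021_cons0; rewrite eqxx andbT.
    (* All filtered entries are at least 1, so starting the path at [v = 1] adds no condition. *)
    move=> srt; rewrite path_sortedE ?srt ?andbT //; last exact: leq_trans.
    by apply/allP => y; rewrite mem_filter => /andP[].
  move=> _ /= /mapP[t tS ->]; move: tS; rewrite mem_suffixes //.
  case/and4P=> /eqP st bt /path_sorted srt /eqP dt.
  split=> /=; rewrite ?st ?des_desc //; first exact/descent_sequence_cons.
  exact/avoids021_cons0.
have -> : 'C(n.+1 + k, 3 * k + 1) * catalan k
          = size (map (cons 0) (suffixes n k 0 1 false)).
  rewrite size_map (size_suffixes n k 0 0) (nsuffixes_bin n k 0).1 ballot_catalan.
  by congr ('C(_, _) * _); lia.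
by apply: card_eq_seq; rewrite map_inj_uniq ?suffixes_uniq // => ? ? [].
Qed.
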